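(* Let $K/k$ be a separable field extension of degree $6$ and let $\widetilde{K}/k$ be its Galois closure. Assume that $\operatorname{Gal}(\widetilde{K}/k)\simeq S_5$ and let $F$ be a field with $K\subseteq F\subsetneq\widetilde{K}$. Then $F/k$ is not Hopf Galois.
   Context: A finite extension of fields $L/k$ is called Hopf Galois if there exists a finite cocommutative $k$-Hopf algebra $H$ such that $L$ is an $H$-module algebra and the $k$-linear map $j: L\otimes_k H\to \operatorname{End}_k(L)$, $j(s\otimes h)(t)=s(ht)$ for $h\in H$, $s,t\in L$, is bijective. *)

(* Defs.v *)
From HB Require Import structures.
From mathcomp Require Import all_boot all_order all_algebra all_fingroup all_field.

Set Implicit Arguments.
Unset Strict Implicit.
Unset Printing Implicit Defensive.

Import GRing.Theory.
Local Open Scope ring_scope.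

(* The tensor product over k of two finite-dimensional spaces, modelled by the
   matrices of coordinates in the bases (vbasis {:U})`_i (x) (vbasis {:V})`_j.
   It satisfies the universal property: see tensor_liftE and tensor_ext below.
   When U = V is an algebra, its product is tensor_mul and not the matrix
   product. *)
Section Tensor.
Variables (k : fieldType) (U V : vectType k).

Definition tensor : Type := 'M[k]_(\dim {:U}, \dim {:V}).

HB.instance Definition _ := Vector.on tensor.

Definition tens (u : U) (v : V) : tensor :=
  \matrix_(i, j) (coord (vbasis {:U}) i u * coord (vbasis {:V}) j v).

Fact tens_linearl v : linear (tens^~ v).
Proof.
by move=> a u u'; apply/matrixP=> i j; rewrite !mxE linearP mulrDl mulrA.
Qed.

Fact tens_linearr u : linear (tens u).
Proof.
by move=> a v v'; apply/matrixP=> i j; rewrite !mxE linearP mulrDr mulrCA.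
Qed.

HB.instance Definition _ :=
  bilinear_isBilinear.Build k U V tensor *:%R *:%R tens
    (tens_linearl, tens_linearr).

Section Lift.
Variable W : lmodType k.

(* The linear map induced by f; meaningful for bilinear f only. *)
Definition tensor_lift (f : U -> V -> W) (x : tensor) : W :=
  \sum_i \sum_j
    (x : 'M_(_, _)) i j *: f (vbasis {:U})`_i (vbasis {:V})`_j.

Fact tensor_lift_is_linear f : linear (tensor_lift f).
Proof.
move=> a x y; rewrite /tensor_lift scaler_sumr -big_split; apply: eq_bigr => i _.
rewrite scaler_sumr -big_split; apply: eq_bigr => j _ /=.
by rewrite !mxE scalerDl scalerA.
Qed.

HB.instance Definition _ f :=
  GRing.isLinear.Build k tensor W *:%R (tensor_lift f) (tensor_lift_is_linear f).

Lemma tensor_liftE (f : U -> V -> W) (u : U) (v : V) :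
    (forall v, linear (f^~ v)) -> (forall u, linear (f u)) ->
  tensor_lift f (tens u v) = f u v.
Proof.
move=> fl fr.
pose fL v' : {linear U -> W} :=
  HB.pack (f^~ v') (GRing.isLinear.Build _ _ _ _ _ (fl v')).
pose fR u' : {linear V -> W} :=
  HB.pack (f u') (GRing.isLinear.Build _ _ _ _ _ (fr u')).
rewrite {2}(coord_vbasis (memvf u)) -[RHS]/(fL v _) linear_sum.
apply: eq_bigr => i _; rewrite linearZ /= {2}(coord_vbasis (memvf v)).
rewrite -[f _ _]/(fR _ _) linear_sum scaler_sumr; apply: eq_bigr => j _.
by rewrite linearZ /= scalerA mxE.
Qed.

Lemma tensor_ext (f g : {linear tensor -> W}) :
  (forall u v, f (tens u v) = g (tens u v)) -> f =1 g.
Proof.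
move=> fg x.
have -> : x = \sum_i \sum_j (x : 'M_(_, _)) i j *:
     tens (vbasis {:U})`_i (vbasis {:V})`_j.
  apply: etrans (matrix_sum_delta x) _.
  apply: (@eq_bigr tensor) => i _; apply: (@eq_bigr tensor) => j _.
  congr (_ *: _); apply/matrixP=> i' j'; rewrite !mxE.
  by rewrite !coord_free ?(basis_free (vbasisP _)) // -natrM mulnb
    ![_ == i'](eq_sym) ![_ == j'](eq_sym).
rewrite !linear_sum; apply: eq_bigr => i _; rewrite !linear_sum.
by apply: eq_bigr => j _; rewrite !linearZ /= fg.
Qed.

End Lift.
End Tensor.

Section TensorMaps.
Variable k : fieldType.

Definition tensor_map (U V U' V' : vectType k) (f : U -> U') (g : V -> V') :
    tensor U V -> tensor U' V' :=
  tensor_lift (fun u v => tens (f u) (g v)).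

Definition tensorA (U V W : vectType k) :
    tensor (tensor U V) W -> tensor U (tensor V W) :=
  tensor_lift (fun x w => tensor_lift (fun u v => tens u (tens v w)) x).

Definition tensorC (U V : vectType k) : tensor U V -> tensor V U :=
  tensor_lift (fun u v => tens v u).

(* (a (x) b) (c (x) d) = ac (x) bd *)
Definition tensor_mul (A B : falgType k) (x y : tensor A B) : tensor A B :=
  tensor_lift (fun a b => tensor_lift (fun c d => tens (a * c) (b * d)) y) x.

Lemma tensor_map_tens (U V U' V' : vectType k) (f : {linear U -> U'})
    (g : {linear V -> V'}) u v :
  tensor_map f g (tens u v) = tens (f u) (g v).
Proof.
by apply: tensor_liftE => w a x y; rewrite linearP (linearPl, linearPr).
Qed.

Lemma tensorA_tens (U V W : vectType k) (u : U) (v : V) (w : W) :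
  tensorA (tens (tens u v) w) = tens u (tens v w).
Proof.
have fE x y z : tensor_lift (fun u v => tens u (tens v z)) (tens x y) =
                tens x (tens y z) :> tensor U (tensor V W).
  apply: tensor_liftE => t a b c; first exact: linearPl.
  by rewrite linearPl linearPr.
rewrite /tensorA tensor_liftE ?fE // => [z | x] a y z'; first exact: linearP.
rewrite /tensor_lift scaler_sumr -big_split; apply: eq_bigr => i _.
rewrite scaler_sumr -big_split; apply: eq_bigr => j _ /=.
by rewrite linearPr linearPr scalerDr !scalerA [_ * a]mulrC.
Qed.

Lemma tensorC_tens (U V : vectType k) (u : U) (v : V) :
  tensorC (tens u v) = tens v u.
Proof.
by apply: tensor_liftE => w a x y; [apply: linearPr | apply: linearPl].
Qed.

Lemma tensor_mul_tens (A B : falgType k) (a c : A) (b d : B) :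
  tensor_mul (tens a b) (tens c d) = tens (a * c) (b * d).
Proof.
have fE x y z t : tensor_lift (fun c d => tens (x * c) (y * d)) (tens z t) =
                  tens (x * z) (y * t) :> tensor A B.
  apply: tensor_liftE => s e p q; rewrite mulrDr -scalerAr.
    exact: linearPl.
  exact: linearPr.
rewrite /tensor_mul tensor_liftE ?fE // => s e p q; rewrite /tensor_lift;
  rewrite scaler_sumr -big_split; apply: eq_bigr => i _;
  rewrite scaler_sumr -big_split; apply: eq_bigr => j _ /=;
  rewrite mulrDl -scalerAl (linearPl, linearPr);
  by rewrite scalerDr !scalerA [_ * e]mulrC.
Qed.

End TensorMaps.

(* Sweedler sums are written with tensor_lift: \sum f h_(1) h_(2) is
   tensor_lift f (comul h). *)
Record hopf_structure (k : fieldType) (H : falgType k) := HopfStructure {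
  comul : {linear H -> tensor H H};
  counit : {linear H -> k^o};
  antipode : {linear H -> H};
  comulA : forall h, tensorA (tensor_map comul idfun (comul h)) =
                     tensor_map idfun comul (comul h);
  counitl : forall h, tensor_lift (fun a b => counit a *: b) (comul h) = h;
  counitr : forall h, tensor_lift (fun a b => counit b *: a) (comul h) = h;
  comul1 : comul 1 = tens 1 1;
  comulM : forall g h, comul (g * h) = tensor_mul (comul g) (comul h);
  counit1 : counit 1 = 1;
  counitM : forall g h, counit (g * h) = counit g * counit h;
  antipodel : forall h,
    tensor_lift (fun a b => antipode a * b) (comul h) = (counit h)%:A;
  antipoder : forall h,
    tensor_lift (fun a b => a * antipode b) (comul h) = (counit h)%:A
}.

Definition cocommutative (k : fieldType) (H : falgType k)
    (hH : hopf_structure H) : Prop :=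
  forall h, tensorC (comul hH h) = comul hH h.

Section HopfGalois.
Variables (k : fieldType) (L : fieldExtType k).

(* act h t stands for the product h t of the H-module L. *)
Record module_algebra (H : falgType k) (hH : hopf_structure H)
    (act : {linear H -> 'End(L)}) : Prop := ModuleAlgebra {
  act1 : forall t, act 1 t = t;
  actM : forall g h t, act (g * h) t = act g (act h t);
  act_unit : forall h, act h 1 = (counit hH h)%:A;
  act_mul : forall h s t,
    act h (s * t) = tensor_lift (fun a b => act a s * act b t) (comul hH h)
}.

(* amull s is t |-> s * t, so this is the map sending s (x) h to
   t |-> s * (h t). *)
Definition hopf_galois_map (H : falgType k) (act : {linear H -> 'End(L)}) :
    tensor L H -> 'End(L) :=
  tensor_lift (fun s h => (amull s \o act h)%VF).

Definition hopf_galois : Prop :=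
  exists (H : falgType k) (hH : hopf_structure H) (act : {linear H -> 'End(L)}),
    [/\ cocommutative hH, module_algebra hH act
      & bijective (hopf_galois_map act)].

End HopfGalois.

(* N is the Galois closure over k of K inside the ambient extension L. *)
Definition galois_closure (k : fieldType) (L : splittingFieldType k)
    (K N : {subfield L}) : Prop :=
  [/\ (K <= N)%VS, galois 1 N
    & forall M : {subfield L}, (K <= M)%VS -> galois 1 M -> (N <= M)%VS].

(* Main.v *)
Require Import Defs.
From HB Require Import structures.
From mathcomp Require Import all_boot all_order all_algebra all_fingroup all_field.
From mathcomp Require Import all_solvable.

(* Every g in Gal(N/k) restricts on F to a unique L-combination of the
   operators h of H, whose coefficient vector in L (x) H is group-like because g
   is multiplicative.  Hence the embeddings of F in N form a group T under
   convolution, Gal(N/k) acts on T by automorphisms, and g |-> g|F is a crossed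
   homomorphism onto T with kernel G' = Gal(N/F); here 1 < G' and |G'| divides
   20, so |T| is 6, 12, 24, 30 or 60.  (This is half of the Greither-Pareigis
   correspondence.)

   The group A = A_5 meets G' nontrivially, so the action of A on T is faithful:
   otherwise the crossed homomorphism would be a homomorphism on A.  But a simple
   group of order 60 acts trivially on every group of order 6, 12, 24 or 30.  If
   |T| = 60, then T has no proper nontrivial invariant normal subgroup, and the
   semidirect product of T and A, of order 3600, cannot act faithfully on the six
   Sylow 5-subgroups of T; its kernel centralizes T, which forces A to act through
   inner automorphisms.  The crossed homomorphism then becomes an
   injective endomorphism of S_5 fixing exactly the two elements 1, t of G', and
   the centralizer of t, a dihedral group of order 8, has no such endomorphism
   preserving A. *)

Set Implicit Arguments.
Unset Strict Implicit.
Unset Printing Implicit Defensive.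

(** * Permutations of five points *)

Section PermutationGroups.
Local Open Scope group_scope.

(** A permutation is encoded by its list of values, on which [vm_compute] can run through all 120
    cases; [code_mul] applies its left factor first, like the product of permutations. *)
Definition S5_code (s : 'S_5) : seq nat := [seq val (s i) | i <- ord_enum 5].
Definition S5_codes : seq (seq nat) := permutations (iota 0 5).
Definition code_mul (c d : seq nat) : seq nat := [seq nth 0 d i | i <- c].
Definition code1 : seq nat := iota 0 5.

Lemma S5_code_inj : injective S5_code.
Proof.
move=> s t /eq_in_map st; apply/permP => i; apply/val_inj/st.
by rewrite mem_ord_enum.
Qed.

Lemma S5_codeM s t : S5_code (s * t) = code_mul (S5_code s) (S5_code t).
Proof.
rewrite /code_mul /S5_code -map_comp; apply/eq_map => i /=.
have si : s i < size (ord_enum 5) by rewrite -(size_map val) val_ord_enum size_iota ltn_ord.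
rewrite permM (nth_map ord0 _ _ si).
suff -> : nth ord0 (ord_enum 5) (s i) = s i by [].
apply/val_inj; rewrite -[LHS](nth_map ord0 0 (@nat_of_ord 5) si).
by rewrite (val_ord_enum 5) nth_iota ?ltn_ord.
Qed.

Lemma S5_code1 : S5_code 1 = code1.
Proof.
by rewrite /code1 -val_ord_enum; apply: eq_map => i; rewrite perm1.
Qed.

Lemma mem_S5_codes (P : pred (seq nat)) :
  all P S5_codes -> forall s, P (S5_code s).
Proof.
move=> /allP PS s; apply: PS; rewrite mem_permutations uniq_perm //.
- by rewrite map_inj_uniq ?ord_enum_uniq // => i j /val_inj/perm_inj.
- move=> j; rewrite -val_ord_enum; apply/mapP/mapP => -[i _ ->].
    by exists (s i); rewrite ?mem_ord_enum.
  by exists (s^-1 i); rewrite ?mem_ord_enum ?permKV.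
Qed.

(** By counting: the 120 permutations have distinct codes in a list of 120 entries. *)
Lemma S5_codes_mem (P : pred (seq nat)) :
  has P S5_codes -> exists s, P (S5_code s).
Proof.
move=> /hasP[c cS Pc].
have [|||_ eqS] := @uniq_min_size _ [seq S5_code s | s : 'S_5] S5_codes.
- by rewrite map_inj_uniq ?enum_uniq //; apply: S5_code_inj.
- by move=> _ /mapP[s _ ->]; apply: (mem_S5_codes (P := mem S5_codes)); apply/allP.
- by rewrite size_map -cardE card_Sn; vm_compute.
by move: cS; rewrite -eqS => /mapP[s _ cE]; exists s; rewrite -cE.
Qed.

Definition code_sq c := code_mul c c.

Lemma S5_codesq s : S5_code (s * s) = code_sq (S5_code s).
Proof. exact: S5_codeM. Qed.

Lemma S5_code_eq s t : (s == t) = (S5_code s == S5_code t).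
Proof. by rewrite (inj_eq S5_code_inj). Qed.

Definition code_square c := has (fun e => c == code_sq e) S5_codes.

Lemma code_squareP s :
  reflect (exists w, s = w * w) (code_square (S5_code s)).
Proof.
apply: (iffP idP) => [/S5_codes_mem[w]|[w ->]].
  by rewrite -S5_codesq -S5_code_eq => /eqP; exists w.
apply/hasP; exists (S5_code w); last by rewrite S5_codesq.
by apply: (mem_S5_codes (P := mem S5_codes)); apply/allP.
Qed.

(* In S_5, unlike in larger symmetric groups, every even permutation is a square;
   this makes parity computable on codes. *)
Lemma mem_Alt5 s : (s \in 'Alt_('I_5)) = code_square (S5_code s).
Proof.
suff -> : 'Alt_('I_5) = [set w * w | w : 'S_5] :> {set _}.
  by apply/imsetP/code_squareP => [[w _ ->]|[w ->]]; exists w.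
apply/esym/eqP; rewrite eqEcard; apply/andP; split.
  by apply/subsetP => _ /imsetP[w _ ->]; rewrite Alt_even odd_permM addbb.
have -> : #|'Alt_('I_5)| = 60.
  by apply: double_inj; rewrite -mul2n card_Alt card_ord.
suff <- : size (undup [seq code_sq c | c <- S5_codes]) = 60.
  rewrite cardE -(size_map S5_code).
  apply: uniq_leq_size; first exact: undup_uniq.
  move=> c; rewrite mem_undup => /mapP[d dS ->].
  have [|w /eqP wE] := @S5_codes_mem (pred1 d); first by apply/hasP; exists d => /=.
  apply/mapP; exists (w * w); last by rewrite S5_codesq wE.
  by rewrite mem_enum; apply/imsetP; exists w.
by vm_compute.
Qed.

(** An involution normalizing the group of a 5-cycle lies in a Frobenius group of order 20, where it
    is the square of a 4-cycle. Reducing the exponent modulo 5 leaves a finite check. *)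
Lemma S5_involution_square (p t : 'S_5) i :
  p != 1 -> p ^+ 5 = 1 -> t != 1 -> t * t = 1 -> p * t = t * p ^+ i ->
  exists s, t = s * s.
Proof.
move=> p1 p5 t1 t2 pt.
have {i pt}[i i5 pt] : exists2 i, i < 5 & p * t = t * p ^+ i.
  by exists (i %% 5); rewrite ?ltn_mod // expg_mod.
pose P c d := [|| c == code1, d == code1, code_sq d != code1,
  iter 5 (code_mul c) code1 != code1,
  all (fun i => code_mul c d != code_mul d (iter i (code_mul c) code1)) (iota 0 5)
  | code_square d].
have codeX n : S5_code (p ^+ n) = iter n (code_mul (S5_code p)) code1.
  by elim: n => [|n IHn]; rewrite ?S5_code1 // expgS S5_codeM IHn.
have PS : all (fun c => all (P c) S5_codes) S5_codes by vm_compute.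
move/mem_S5_codes/(_ p)/mem_S5_codes/(_ t): PS; rewrite /P.
rewrite -S5_codesq -codeX p5 t2 -S5_code1 !(inj_eq S5_code_inj) eqxx.
rewrite (negPf p1) (negPf t1) -[~~ true]/false !orFb.
case/orP=> [/allP/(_ i)|/code_squareP //].
by rewrite mem_iota S5_code1 -codeX -!S5_codeM pt eqxx => /(_ i5).
Qed.

(* [vm_compute] is call by value: only the conditionals are lazy. *)
Lemma S5_cent_double_transposition (t s : 'S_5) :
  t != 1 -> t * t = 1 -> t = s * s ->
  exists x, [/\ x \in 'Alt_('I_5), x \notin [:: 1; t], x * t = t * x &
   forall y, y \in 'Alt_('I_5) -> y * t = t * y -> y \in [:: 1; t; x; x * t]].
Proof.
(* The even permutations commuting with a double transposition [d] form a Klein four-group; the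
   search below finds a second generator [c]. *)
pose Q d c e := if code_mul e d == code_mul d e then
  if e \in [:: code1; d; c; code_mul c d] then true else ~~ code_square e
  else true.
pose P d := if [|| d == code1, code_sq d != code1 | ~~ code_square d] then true
  else has (fun c =>
    if (c \notin [:: code1; d]) && (code_mul c d == code_mul d c) then
    if code_square c then all (Q d c) S5_codes else false else false) S5_codes.
have PS : all P S5_codes by vm_compute.
move=> t1 t2 tE; move/mem_S5_codes/(_ t): PS; rewrite /P.
have tS : code_square (S5_code t) by apply/code_squareP; exists s.
rewrite -S5_codesq t2 -S5_code1 -S5_code_eq (negPf t1) eqxx tS.
rewrite -[[|| _, _ | _]]/false => /S5_codes_mem[x].
case: ifP => // /andP[x1t xt]; case: ifP => // Ax.
move/mem_S5_codes=> xP; exists x; split=> [|||y Ay yt].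
- by rewrite mem_Alt5.
- by move: x1t; rewrite !inE !S5_code_eq.
- by apply/eqP; rewrite S5_code_eq !S5_codeM.
move: (xP y); rewrite /Q -mem_Alt5 Ay -!S5_codeM yt eqxx !inE -S5_code1.
by rewrite -!S5_code_eq; case: ifP.
Qed.

(** A permutation whose square is an involution that is itself a square root of 1 in this sense is a
    4-cycle, determined by its square up to inversion; the inverse of [s] is [s * t]. *)
Lemma S5_sqrt_double_transposition (t s w : 'S_5) :
  t != 1 -> t * t = 1 -> s * s = t -> w * w = t -> w \in [:: s; s * t].
Proof.
pose P c d := [|| code_sq c == code1, code_sq (code_sq c) != code1,
  code_sq c != code_sq d | d \in [:: c; code_mul c (code_sq c)]].
have PS : all (fun c => all (P c) S5_codes) S5_codes by vm_compute.
move=> t1 t2 st wt; move/mem_S5_codes/(_ s)/mem_S5_codes/(_ w): PS; rewrite /P.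
rewrite -!S5_codesq st wt t2 -S5_code1 -S5_code_eq (negPf t1) !eqxx /= !inE.
by rewrite -!S5_codeM -!S5_code_eq.
Qed.

Lemma S5_order4_odd (t s : 'S_5) :
  t != 1 -> t * t = 1 -> s * s = t -> s \notin 'Alt_('I_5).
Proof.
pose P c := [|| code_sq c == code1, code_sq (code_sq c) != code1 | ~~ code_square c].
have PS : all P S5_codes by vm_compute.
move=> t1 t2 st; move/mem_S5_codes/(_ s): PS; rewrite /P mem_Alt5.
by rewrite -!S5_codesq st t2 -S5_code1 -S5_code_eq (negPf t1) !eqxx.
Qed.

End PermutationGroups.

(** * Actions of simple groups of order 60 *)

Section Actions.
Local Open Scope group_scope.

(** * Triviality criteria for actions: perfect groups, fixed points, Sylow counts *)

Section PerfectActions.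
Variable gT : finGroupType.
Implicit Types A M X R : {group gT}.

Lemma simple60_perfect A : simple A -> #|A| = 60 -> [~: A, A] = A.
Proof.
move=> simA oA; have /simpleP[_ norA] := simA.
have [/commG1P cAA|//] := norA _ (der_normal 1 A).
by have := simple_sol_prime (abelian_sol cAA) simA; rewrite oA.
Qed.

(** Three subgroups lemma: both [M, A, A] and [A, M, A] are trivial, hence so is [A, A, M], and [A]
    is perfect. *)
Lemma perfect_stab A M X :
  [~: A, A] = A -> A \subset 'C(X) -> [~: M, A] \subset X -> A \subset 'C(M).
Proof.
move=> pA cX sX; have MA1 : [~: M, A, A] = 1.
  by apply/commG1P; apply: subset_trans sX _; rewrite centsC.
apply/commG1P; rewrite -{1}pA; apply: three_subgroup; last by [].
by rewrite [[~: A, M]]commGC.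
Qed.

(** The kernel of the action is normal in [A] and contains [R]. *)
Lemma simple_cent A R X :
  simple A -> A \subset 'N(X) -> R \subset A -> R :!=: 1 -> R \subset 'C(X) ->
  A \subset 'C(X).
Proof.
case/simpleP=> _ norA nX sRA R1 cRX.
have nC : 'C_A(X) <| A.
  by rewrite /normal subsetIl normsI ?normG // norms_cent.
have [C1|<-] := norA _ nC; last exact: subsetIr.
by case/negP: R1; rewrite -subG1 -C1 subsetI sRA.
Qed.

(** The fixed points of a 5-group acting on a group of order [n] form a subgroup whose order divides
    [n] and is congruent to [n] modulo 5; the condition leaves only [n] itself. *)
Definition rigid5 n := all (fun d => (d == n %[mod 5]) ==> (d == n)) (divisors n).

Lemma pgroup5_cent R X :
  5.-group R -> R \subset 'N(X) -> rigid5 #|X| -> R \subset 'C(X).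
Proof.
move=> pR nX /allP/(_ #|'C_X(R)|).
rewrite -dvdn_divisors ?cardG_gt0 // cardSg ?subsetIl // => /(_ isT).
have /(pgroup_fix_mod pR) -> : [acts R, on X | 'J] by rewrite astabsJ.
rewrite afixJ eqxx /= => /eqP oC.
have /setIidPl : 'C_X(R) = X by apply/eqP; rewrite eqEcard subsetIl oC /=.
by rewrite centsC.
Qed.

(** The number of Sylow subgroups fixed by [R] is congruent modulo 5 to the number of all of them,
    and both are below 5. *)
Lemma norm_few_Sylow R M p :
  5.-group R -> R \subset 'N(M) -> #|'Syl_p(M)| < 5 ->
  forall P : {group gT}, p.-Sylow(M) P -> R \subset 'N(P).
Proof.
move=> pR nM few P sylP.
have acR : [acts R, on 'Syl_p(M) | 'JG].
  apply/actsP=> x Rx Q; rewrite !inE /=.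
  by rewrite pHallJnorm // (subsetP nM).
have := pgroup_fix_mod pR acR.
rewrite !modn_small //; last exact: leq_ltn_trans (subset_leq_card (subsetIl _ _)) few.
move/eqP; rewrite eq_sym => /eqP oF.
have : P \in 'Fix_('Syl_p(M) | 'JG)(R).
  suff -> : 'Fix_('Syl_p(M) | 'JG)(R) = 'Syl_p(M) by rewrite inE.
  by apply/eqP; rewrite eqEcard subsetIl oF /=.
case/setIP=> _ /afixP fP; apply/subsetP=> x Rx; rewrite inE.
by have /(congr1 val)/= -> := fP x Rx.
Qed.

(** Distinct subgroups of prime order p meet trivially, and each contributes p - 1 elements of order
    p. *)
Lemma card_Sylow_prime_elements M p :
  prime p -> (#|M|`_p)%N = p ->
  #|'Syl_p(M)| * p.-1 <= #|[set x in M | #[x] == p]|.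
Proof.
move=> pr_p oMp.
pose S := [set (gval P)^# | P : {group gT} in 'Syl_p(M)].
have oP (P : {group gT}) : P \in 'Syl_p(M) -> #|P| = p.
  by rewrite inE => /card_Hall ->.
have oS B : B \in S -> #|B| = p.-1.
  by case/imsetP=> P /oP oP' ->; rewrite -oP' [in RHS](cardsD1 1 P) group1.
have cyc (P : {group gT}) x : P \in 'Syl_p(M) -> x \in P^# -> <[x]> = P.
  move=> sylP /setD1P[x1 Px]; have := oP _ sylP.
  move=> o; apply/eqP; rewrite eqEcard cycle_subG Px o -[#|_|]/(#[x]).
  have: #[x] %| p by rewrite -o order_dvdG.
  by case/primeP: pr_p => _ h /h; rewrite order_eq1 (negPf x1) /= => /eqP->.
have tS : trivIset S.
  apply/trivIsetP => _ _ /imsetP[P sP ->] /imsetP[Q sQ ->]; apply: contraR.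
  by case/pred0Pn=> x /andP[/(cyc _ _ sP) <- /(cyc _ _ sQ) <-].
have cS : #|S| = #|'Syl_p(M)|.
  apply: card_in_imset => P Q sP sQ PQ.
  have /card_gt0P[x xP] : 0 < #|P^#|.
    rewrite oS; last by apply/imsetP; exists P.
    by rewrite -subn1 subn_gt0 prime_gt1.
  by apply/val_inj; rewrite /= -(cyc _ _ sP xP) -(cyc Q x sQ) // -PQ.
rewrite -cS -sum_nat_const -(eq_bigr _ oS) (eqP tS).
apply/subset_leq_card/bigcupsP => _ /imsetP[P sP ->]; apply/subsetP => x xP.
rewrite inE orderE (cyc _ _ sP xP) oP // eqxx andbT.
by move: sP xP; rewrite inE => /pHall_sub/subsetP sPM /setD1P[_ /sPM].
Qed.

Lemma few_Sylow M p :
  prime p -> all (fun d => (d %% p == 1%N) ==> (d < 5)) (divisors #|M|) ->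
  #|'Syl_p(M)| < 5.
Proof.
move=> pr_p /allP/(_ #|'Syl_p(M)|).
by rewrite -dvdn_divisors // card_Syl_dvd card_Syl_mod // eqxx; apply.
Qed.

(** Otherwise there are 10 Sylow 3-subgroups and 6 Sylow 5-subgroups, giving 20 + 24 = 44 elements
    of order 3 or 5. *)
Lemma card30_few_Sylow M :
  #|M| = 30 -> (#|'Syl_3(M)| < 5) || (#|'Syl_5(M)| < 5).
Proof.
move=> oM; rewrite -[_ || _]negbK negb_or -!leqNgt; apply/negP => /andP[n3 n5].
have many p m : prime p -> (30`_p)%N = p -> 4 < #|'Syl_p(M)| ->
    all (fun d => (d %% p == 1%N) ==> (4 < d) ==> (m <= d * p.-1)) (divisors 30) ->
  m <= #|[set x in M | #[x] == p]|.
  move=> pr_p p30 n_p /allP/(_ #|'Syl_p(M)|).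
  rewrite -dvdn_divisors // -{1}oM card_Syl_dvd card_Syl_mod // n_p => /(_ isT).
  by move/leq_trans; apply; apply: card_Sylow_prime_elements => //; rewrite oM.
have := many 3 20 isT _ n3 isT; have := many 5 24 isT _ n5 isT.
rewrite !p_part => /(_ erefl) m5 /(_ erefl) m3.
have: 44 <= #|M|.
  rewrite (leq_trans (leq_add m3 m5)) // -cardsUI.
  have -> : [set x in M | #[x] == 3] :&: [set x in M | #[x] == 5] = set0.
    apply/setP=> x; rewrite !inE; apply/negP => /andP[/andP[_ /eqP->]].
    by rewrite andbF.
  by rewrite cards0 addn0; apply/subset_leq_card/subsetP => x; rewrite !inE -andb_orr => /andP[].
by rewrite oM.
Qed.

Lemma Sylow_span_norm M p :
  'N(M) \subset 'N(<<\bigcup_(P in 'Syl_p(M)) P>>).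
Proof.
apply/norms_gen/subsetP => a nMa; rewrite inE; apply/subsetP => _ /imsetP[x /bigcupP[P sylP Px] ->].
apply/bigcupP; exists (P :^ a)%G.
  by move: sylP; rewrite !inE pHallJnorm.
by rewrite memJ_conjg.
Qed.
End PerfectActions.

(** The proper divisors of 60, together with 24 and 8 = 24 / 3: a list closed under exact division
    by multiples of 3 or 5, which is the inductive step below. *)
Definition A5_trivial_orders : seq nat :=
  [:: 1%N; 2; 3; 4; 5; 6; 8; 10; 12; 15; 20; 24; 30].

(** Induction on the order. A Sylow 5-subgroup [R] of [A] centralizes either [M] or all Sylow
    p-subgroups of [M] for a suitable p. In the second case [A] centralizes their span [D] and, by
    induction, [M / D]. *)
Lemma A5_trivial_action n (gT : finGroupType) (A M : {group gT}) :
  simple A -> #|A| = 60 -> A \subset 'N(M) ->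
  #|M| = n -> n \in A5_trivial_orders -> A \subset 'C(M).
Proof.
elim/ltn_ind: n gT A M => n IHn gT A M simA oA nMA oM n_in.
have [R sylR] := Sylow_exists 5 A; have pR := pHall_pgroup sylR.
have oR : #|R| = 5 by rewrite (card_Hall sylR) oA p_part.
have sRA := pHall_sub sylR; have R1 : R :!=: 1 by rewrite -cardG_gt1 oR.
have nMR := subset_trans sRA nMA.
have small : rigid5 #|M| -> A \subset 'C(M).
  by move=> /(pgroup5_cent pR nMR); apply: simple_cent.
suff [[p [oP few]]|] : (exists p : nat, (n`_p)%N \in [:: 3; 5] /\ #|'Syl_p(M)| < 5)
    \/ rigid5 #|M|; [|exact: small|].
- pose D := <<\bigcup_(P in 'Syl_p(M)) P>>.
  have nDM : 'N(M) \subset 'N(D) := Sylow_span_norm M p.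
  have sDM : D \subset M.
    by rewrite gen_subG; apply/bigcupsP => P; rewrite inE => /pHall_sub.
  have cDR : R \subset 'C(D).
    rewrite centsC gen_subG; apply/bigcupsP => P; rewrite inE => sylP.
    rewrite centsC; apply: pgroup5_cent => //; first exact: norm_few_Sylow few _ sylP.
    by move: oP; rewrite (card_Hall sylP) oM !inE => /orP[]/eqP->.
  have cDA : A \subset 'C(D).
    by apply: simple_cent cDR => //; apply: subset_trans nMA _.
  (* Otherwise [A] would lie in [D], which it centralizes, and be abelian. Hence [A] embeds in the
     quotient by [D]. *)
  have AD1 : D :&: A = 1.
    have /simpleP[_ /(_ [group of D :&: A])[|//|DA]] := simA.
      rewrite /normal subsetIr normsI ?normG //.
      exact: subset_trans (cent_sub _).
    have: abelian A by rewrite /abelian -{2}DA (subset_trans cDA) ?centS ?subsetIl.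
    by move/abelian_sol/simple_sol_prime/(_ simA); rewrite oA.
  have nDA := subset_trans nMA nDM.
  have isoA := quotient_isog nDA AD1.
  have nDM' := subset_trans (normG M) nDM.
  have [P sylP] := Sylow_exists p M.
  have sPD : P \subset D.
    by apply/sub_gen/(bigcup_sup P); rewrite ?inE.
  have oP' : #|P| \in [:: 3; 5] by rewrite (card_Hall sylP) oM.
  have pD : 1 < #|D|.
    apply: leq_trans (subset_leq_card sPD).
    by move: oP'; rewrite !inE => /orP[]/eqP->.
  apply: perfect_stab (simple60_perfect simA oA) cDA _.
  rewrite -quotient_cents2 // centsC.
  have oMD : #|M / D| = n %/ #|D| by rewrite card_quotient // -divgS // oM.
  apply: IHn oMD _ => //.
  - by rewrite ltn_Pdiv // -oM.
  - by rewrite -(isog_simple isoA).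
  - by rewrite -(card_isog isoA).
  - exact: quotient_norms.
  - have cl : all (fun m => all (fun d => (3 %| d) || (5 %| d) ==>
      (m %/ d \in A5_trivial_orders)) (divisors m)) A5_trivial_orders by vm_compute.
    move/allP/(_ n n_in)/allP/(_ #|D|): cl.
    rewrite -dvdn_divisors -oM ?cardSg // => /(_ isT)/implyP -> //.
    by have := cardSg sPD; move: oP'; rewrite !inE => /orP[]/eqP-> ->; rewrite ?orbT.
(* For order 30 the divisor test would allow 10 and 6 Sylow subgroups, so elements have to be
   counted. *)
have [n30|n30] := eqVneq n 30.
  left; have /orP[few|few] := card30_few_Sylow (etrans oM n30); [exists 3|exists 5];
  by rewrite few n30 !p_part.
have good : all (fun m => [|| m == 30, rigid5 m | has (fun p : nat =>
    [&& prime p, (p ^ logn p m)%N \in [:: 3; 5] &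
     all (fun d => (d %% p == 1%N) ==> (d < 5)) (divisors m)]) [:: 3; 5]])
  A5_trivial_orders by vm_compute.
move/allP/(_ n n_in): good; rewrite (negPf n30) orFb -{1}oM => /orP[|/hasP[p _]].
  by right.
rewrite -p_part => /and3P[pr_p np few]; left; exists p; split=> //.
by apply: few_Sylow => //; rewrite oM.
Qed.

(** Modulo the pointwise stabilizer, [A] embeds in the symmetric group on [S]. *)
Lemma index_astab_fact (aT : finGroupType) (rT : finType)
    (to : {action aT &-> rT}) (A : {group aT}) (S : {set rT}) :
  [acts A, on S | to] -> #|A : 'C_A(S | to)| <= #|S|`!.
Proof.
move=> acS; have nSA : actby_cond A S to by [].
pose f := actperm_morphism <[nSA]>.
have oI : #|A : 'ker f| = #|f @* A| by rewrite card_morphim setIid.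
have sK : 'ker f \subset 'C_A(S | to).
  apply/subsetP => x; rewrite ker_actperm => /setIP[Ax]; rewrite inE => /subsetP fx.
  rewrite inE Ax; apply/astabP => y Sy; have := fx y (in_setT y).
  by rewrite inE actbyE // => /eqP.
rewrite (leq_trans (dvdn_leq (indexg_gt0 _ _) (indexgS A sK))) // oI -card_perm subset_leq_card //.
apply/subsetP => _ /morphimP[x _ Ax ->]; apply/subsetP => y.
by rewrite !inE /= actpermE /= /actby; case: ifP => [/andP[]|]; rewrite ?eqxx.
Qed.

(** * Faithful actions of a simple group of order 60 on a group of order 60 *)

Section SimpleActionOrder60.
Variables (gT : finGroupType) (B N : {group gT}).
Hypotheses (simB : simple B) (oB : #|B| = 60) (oN : #|N| = 60).
Hypotheses (nNB : B \subset 'N(N)) (tiBN : B :&: N = 1) (tiBC : B :&: 'C(N) = 1).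

Let B1 : B :!=: 1.
Proof. by rewrite -cardG_gt1 oB. Qed.

(** If [M] were proper, [M] and [N / M] would have orders in [A5_trivial_orders]; [B] would act
    trivially on both, hence on [N], against faithfulness. *)
Lemma no_invariant_normal (M : {group gT}) :
  M <| N -> B \subset 'N(M) -> M :!=: 1 -> M :=: N.
Proof.
move=> nsMN nMB M1; apply/eqP/idPn => neMN; have [sMN nMN] := andP nsMN.
have oMd : #|M| %| 60 by rewrite -oN cardSg.
have ltM : #|M| < 60 by rewrite -oN proper_card // properEneq neMN.
have gtM : 1 < #|M| by rewrite cardG_gt1.
have ords : all (fun d => (1 < d < 60) ==> (d \in A5_trivial_orders) &&
   (60 %/ d \in A5_trivial_orders)) (divisors 60) by vm_compute.
move/allP/(_ #|M|): ords; rewrite -dvdn_divisors // gtM ltM => /(_ oMd)/andP[oM oNM].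
have cMB := A5_trivial_action simB oB nMB (erefl _) oM.
have tiMB : M :&: B = 1.
  by apply/trivgP; rewrite /= -tiBN [M :&: B]setIC setIS.
have isoB := quotient_isog nMB tiMB.
have oq : #|N / M| = 60 %/ #|M| by rewrite card_quotient // -divgS // oN.
have cq : B / M \subset 'C(N / M).
  apply: A5_trivial_action oq oNM.
  - by rewrite -(isog_simple isoB).
  - by rewrite -(card_isog isoB).
  - exact: quotient_norms.
have /setIidPl cBN : B \subset 'C(N).
  apply: perfect_stab (simple60_perfect simB oB) cMB _.
  by rewrite -quotient_cents2 // centsC.
by case/negP: B1; rewrite -cBN tiBC.
Qed.

Lemma core5_trivial : 'O_5(N) = 1.
Proof.
apply/eqP/idPn => /no_invariant_normal E.
have {}E : 'O_5(N) = N.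
  apply: E; first exact: pcore_normal.
  exact: char_norm_trans (pcore_char _ _) nNB.
by have := pcore_pgroup 5 N; rewrite E /pgroup oN.
Qed.

Lemma not_normal_Sylow5 (P : {group gT}) : 5.-Sylow(N) P -> ~~ (P <| N).
Proof.
move=> sylP; apply/negP => nsP.
have := pcore_max (pHall_pgroup sylP) nsP; rewrite core5_trivial => /trivgP P1.
by have := card_Hall sylP; rewrite P1 cards1 oN p_part.
Qed.

Lemma center_trivial : N :&: 'C(N) = 1.
Proof.
apply/eqP/idPn => Z1; have ZN : 'Z(N) = N.
  apply: no_invariant_normal Z1; first exact: center_normal.
  exact: char_norm_trans (center_char _) nNB.
have abN : abelian N by apply/center_idP.
have [P sylP] := Sylow_exists 5 N.
case/negP: (not_normal_Sylow5 sylP); rewrite /normal (pHall_sub sylP).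
exact: sub_abelian_norm (pHall_sub sylP).
Qed.

Lemma card_Syl5 : #|'Syl_5(N)| <= 6.
Proof.
have : #|'Syl_5(N)| != 1%N.
  apply/negP => /normal_sylowP[P sylP nsP].
  by case/negP: (not_normal_Sylow5 sylP).
have ords : all (fun d => (d %% 5 == 1%N) ==> (d != 1%N) ==> (d <= 6)) (divisors 60).
  by vm_compute.
move/allP/(_ #|'Syl_5(N)|): ords.
rewrite -dvdn_divisors // -{1}oN card_Syl_dvd card_Syl_mod // => /(_ isT).
by rewrite eqxx implyTb => /implyP.
Qed.

(** The kernel [L] of [G] acting on the Sylow 5-subgroups of [N] is nontrivial and centralizes [N].
    Simplicity of [G / N] then yields G = N C, so [B] acts on [N] by inner automorphisms. *)
Lemma sub_mul_cent : B \subset N * 'C(N).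
Proof.
pose G := (N <*> B)%G.
have nNG : G \subset 'N(N) by rewrite join_subG normG.
have oG : #|G| = 3600.
  by rewrite /= norm_joinEr // TI_cardMg ?oB ?oN // setIC.
have [sNG sBG] : N \subset G /\ B \subset G by apply/andP; rewrite -join_subG.
have acG : [acts G, on 'Syl_5(N) | 'JG].
  apply/actsP=> x Gx P; rewrite !inE /= pHallJnorm // (subsetP nNG) //.
pose L := 'C_G('Syl_5(N) | 'JG)%G.
have nsLG : L <| G by apply: norm_normalI; apply: subset_trans (astab_norm _ _).
(* The order 3600 exceeds 6! = 720. *)
have L1 : L :!=: 1.
  apply/eqP => L1; have := index_astab_fact acG.
  rewrite -[#|_ : _|]/(#|G : L|) L1 indexg1 oG.
  by move=> /leq_trans/(_ (leq_fact card_Syl5)).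
(* Otherwise [N] lies in [L] and normalizes its own Sylow 5-subgroups. *)
have nNL : N :&: L = 1.
  apply/eqP/idPn => /no_invariant_normal NL.
  have [P sylP] := Sylow_exists 5 N.
  case/negP: (not_normal_Sylow5 sylP); rewrite /normal (pHall_sub sylP).
  have nLG := normal_norm nsLG.
  rewrite -NL.
  - apply/subsetP => x /setIP[_ /setIP[_ /astabP/(_ P)]]; rewrite !inE => /(_ sylP) E.
    by have /(congr1 val)/= -> := E.
  - by rewrite norm_normalI // (subset_trans sNG).
  - by rewrite normsI // (subset_trans sBG).
have cLN : L \subset 'C(N).
  apply/commG1P/trivgP; rewrite -nNL setIC commg_subI // subsetI subxx.
    by rewrite (subset_trans (normal_sub nsLG)).
  by rewrite (subset_trans sNG) // normal_norm.
pose C := 'C_G(N)%G.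
have nsC : C <| G by apply: norm_normalI; apply: subset_trans nNG (cent_norm _).
have nNC : C \subset 'N(N) := subset_trans (normal_sub nsC) nNG.
have C1 : C :!=: 1.
  by apply: contraNneq L1 => C1; rewrite -subG1 -C1 subsetI normal_sub.
have isoB : B \isog B / N by rewrite quotient_isog // setIC.
have GB : G / N = B / N by apply: quotientYidl.
(* [C] meets [N] trivially, so its image in the simple quotient is nontrivial, hence everything. *)
have /simpleP[_ /(_ (C / N)%G)] : simple (B / N) by rewrite -(isog_simple isoB).
rewrite /= -GB => -[|CN|CN]; first exact: quotient_normal.
  case/negP: C1; rewrite -subG1 -center_trivial subsetI subsetIr andbT.
  by rewrite -quotient_sub1 // CN.
rewrite (subset_trans sBG) // (subset_trans (_ : _ \subset N * C)) //.
  by rewrite -quotientSK // CN.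
by rewrite mulgS // subsetIr.
Qed.

(** One inclusion is known, and both products have 60 times the order of the centralizer. Thus each
    element of [N] acts on [N] as some element of [B]. *)
Lemma mul_cent_eq : N * 'C(N) = B * 'C(N).
Proof.
apply/esym/eqP; rewrite eqEcard; apply/andP; split.
  by rewrite (subset_trans (mulSg _ sub_mul_cent)) // -mulgA mulGid.
by rewrite !TI_cardMg ?center_trivial // oB oN.
Qed.
End SimpleActionOrder60.

(* A crossed homomorphism [n] for the conjugation action through [a] gives a
   second homomorphism [g |-> a g * n g], which agrees with [a] where [n] is
   trivial. *)
Lemma no_twisted_endomorphism (hT : finGroupType) (t s : 'S_5)
    (a : {morphism [set: 'S_5] >-> hT}) (n : 'S_5 -> hT) :
  {in 'Alt_('I_5) &, injective a} ->
  (forall g h, n (g * h) = n g ^ a h * n h) ->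
  (forall g, exists2 v, v \in 'Alt_('I_5) & n g = a v) ->
  (forall g, n g = 1 <-> g \in [:: 1; t]) ->
  t != 1 -> t * t = 1 -> t = s * s -> False.
Proof.
move=> inja nM nA n1 t1 t2 ts.
have aM g h : a (g * h) = a g * a h by rewrite morphM ?in_setT.
pose b g := a g * n g.
have bE g h : b (g * h) = b g * b h.
  by rewrite /b aM nM conjgE !mulgA mulgK.
pose bm := Morphism (in2W bE : {in [set: 'S_5] &, {morph b : g h / g * h}}).
have nt : n t = 1 by apply/n1; rewrite !inE eqxx orbT.
have bt : b t = a t by rewrite /b nt mulg1.
have At : t \in 'Alt_('I_5) by rewrite mem_Alt5; apply/code_squareP; exists s.
have sA : s \notin 'Alt_('I_5) by apply: (S5_order4_odd t1).
have at1 : a t != 1 by apply: contra_neq t1 => at1; apply: inja; rewrite ?morph1.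
(* By simplicity, since [b t = a t] is not 1. *)
have injb g : g \in 'Alt_('I_5) -> b g = 1 -> g = 1.
  have /simpleP[_ norA] : simple 'Alt_('I_5) by apply: simple_Alt5; rewrite card_ord.
  move=> Ag bg1; have : g \in 'Alt_('I_5) :&: 'ker bm.
    by rewrite inE Ag; apply/kerP; rewrite ?in_setT.
  have [|->|KA] := norA ('Alt_('I_5) :&: 'ker bm)%G; last 2 first.
  - by move/set1P.
  - have : t \in 'Alt_('I_5) :&: 'ker bm by rewrite KA.
    by case/setIP=> _ /mker /= E; rewrite -bt E eqxx in at1.
  by apply: norm_normalI; apply: subset_trans (ker_norm bm); apply: subsetT.
have [x [Ax x1t xt xC]] := S5_cent_double_transposition t1 t2 ts.
(* The element [y] with [b x = a y] commutes with [t], so it is 1, [t], [x] or [x * t]; injectivity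
   of [b] and the zero set of [n] exclude the first three. *)
have nx : n x = a t.
  have [v Av nv] := nA x; have [y y_def] : {y | y = x * v} by exists (x * v).
  have Ay : y \in 'Alt_('I_5) by rewrite y_def groupM.
  have bx : b x = a y by rewrite y_def /b nv aM.
  have /(xC _ Ay) : y * t = t * y.
    by apply: inja; rewrite ?groupM // !aM -bt -bx -!bE xt.
  rewrite !inE => /or4P[]/eqP yE.
  - by have x1 := injb x Ax (etrans bx (etrans (congr1 a yE) (morph1 a))); rewrite x1 mem_head in x1t.
  - have : x * t^-1 = 1.
      apply: injb; rewrite ?groupM ?groupV // bE bx yE -bt -bE mulgV.
      by rewrite -[b 1]/(bm 1) morph1.
    by move/(canRL (mulgKV _)); rewrite mul1g => xE; rewrite xE !inE eqxx orbT in x1t.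
  - have v1 : v = 1 by apply: (mulgI x); rewrite mulg1 -y_def.
    have /n1 xin : n x = 1 by rewrite nv v1 morph1.
    by rewrite xin in x1t.
  - by have -> : t = v by apply: (mulgI x); rewrite -yE -y_def.
(* Here [s * v] is a square root of [t], so it is [s] or [s * t]; the first would give [n s = 1],
   although [s] is odd. *)
have ns : n s = a t.
  have [v Av nv] := nA s.
  have bs : b s = a (s * v) by rewrite /b nv aM.
  have sv2 : s * v * (s * v) = t.
    apply: inja => //.
      by rewrite Alt_even odd_permM addbb.
    by rewrite aM -bs -bE -ts bt.
  have := S5_sqrt_double_transposition t1 t2 (esym ts) sv2.
  rewrite !inE => /orP[]/eqP svE; last by have -> : t = v by apply: (mulgI s).
  have v1 : v = 1 by apply: (mulgI s); rewrite mulg1.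
  have /n1 : n s = 1 by rewrite nv v1 morph1.
  by rewrite !inE => /orP[]/eqP sE; rewrite sE ?group1 ?At in sA.
(* The two values [a t] cancel, so [x * s] is 1 or [t], an even permutation, while [x] is even and
   [s] odd. *)
have /n1 xs : n (x * s) = 1.
  have ats : a t ^ a s = a t.
    by rewrite conjgE -!aM {1}ts -mulgA -ts aM mulKg.
  by rewrite nM nx ns ats -aM t2 morph1.
have Axs : x * s \in 'Alt_('I_5).
  by move: xs; rewrite mem_seq2 => /orP[]/eqP->.
by case/negP: sA; rewrite -(mulKg x s) groupM ?groupV.
Qed.

End Actions.

(** * Crossed homomorphisms on S_5 *)

Section CrossedHom.
Local Open Scope group_scope.

Lemma card_S5 : #|[set: 'S_5]| = 120.
Proof. by rewrite cardsT card_Sn. Qed.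

Lemma card_Alt5 : #|'Alt_('I_5)| = 60.
Proof. by apply: double_inj; rewrite -mul2n card_Alt card_ord. Qed.

Lemma simple_Alt_I5 : simple 'Alt_('I_5).
Proof. by apply: simple_Alt5; rewrite card_ord. Qed.

(** A group of order 20 has a normal Sylow 5-subgroup, so [t] conjugates a generator [p] of it to a
    power of [p]. *)
Lemma order20_involution_square (B : {group 'S_5}) (t : 'S_5) :
  #|B| = 20 -> t \in B -> t != 1 -> t * t = 1 -> exists s, t = s * s.
Proof.
move=> oB Bt t1 t2; have [|P sylP /andP[_ nPB]] := normal_sylowP 5 B _.
  have ords : all (fun d => (d %% 5 == 1%N) ==> (d == 1%N)) (divisors 20).
    by vm_compute.
  move/allP/(_ #|'Syl_5(B)|): ords.
  by rewrite -dvdn_divisors // -{1}oB card_Syl_dvd card_Syl_mod // eqxx; apply.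
have oP : #|P| = 5 by rewrite (card_Hall sylP) oB p_part.
have /cyclicP[p Pp] : cyclic P by apply: prime_cyclic; rewrite oP.
have op : #[p] = 5 by rewrite orderE -Pp.
have /cycleP[i pt] : p ^ t \in <[p]>.
  by rewrite -Pp memJ_norm ?(subsetP nPB) // Pp cycle_id.
apply: (@S5_involution_square p t i) => //.
- by rewrite -order_eq1 op.
- by have := expg_order p; rewrite op.
- by rewrite -pt conjgE mulKVg.
Qed.

(** The action is conjugation in an ambient group, so that [N] and the image of [a] can be compared
    modulo the centralizer of [N]. *)
Lemma no_S5_crossed_hom_in (gT : finGroupType) (N : {group gT})
    (a : {morphism [set: 'S_5] >-> gT}) (n : 'S_5 -> gT) (B : {group 'S_5}) :
  (forall g, a g \in 'N(N)) -> (forall g, n g \in N) ->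
  (forall g h, n (g * h) = n g ^ a h * n h) ->
  (forall g, a g \in N -> a g = 1) -> (forall g, a g \in 'C(N) -> a g = 1) ->
  (#|N| * #|[set g | n g == 1%g]|)%N = 120 ->
  #|B| = 20 -> (forall g, n g = 1 -> g \in B) ->
  (exists2 t, t != 1 & n t = 1) -> False.
Proof.
move=> aN nN nM aN1 aC1 oNK oB nB [t0 t01 nt0].
have aM g h : a (g * h) = a g * a h by rewrite morphM ?in_setT.
have n1 : n 1 = 1.
  by apply: (mulgI (n 1)); rewrite mulg1 -{3}[1](mulg1 1) nM morph1 conjg1.
have gK : group_set [set g | n g == 1%g].
  apply/group_setP; split=> [|g h]; rewrite !inE ?n1 // => /eqP ng /eqP nh.
  by rewrite nM ng nh conj1g mulg1.
pose K := Group gK; pose A := 'Alt_('I_5)%G.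
have inK g : (g \in K) = (n g == 1) by rewrite inE.
have oA : #|A| = 60 := card_Alt5.
have simA : simple A := simple_Alt_I5.
have sKB : K \subset B by apply/subsetP => g; rewrite inE => /eqP/nB.
have oK20 : #|K| %| 20 by rewrite -oB cardSg.
have oK1 : 1 < #|K|.
  by rewrite cardG_gt1; apply/trivgPn; exists t0; rewrite // inK nt0.
have AS : A <| [set: 'S_5].
  by have := Alt_normal 'I_5; rewrite /normal !subsetT => /andP[_]; apply: subset_trans (subsetT _).
have nA1 (X : {group 'S_5}) : A \subset 'N(X) -> A :&: X = 1 \/ A \subset X.
  have /simpleP[_ norA] := simA => nAX.
  have [|AX|AX] := norA (A :&: X)%G; [exact: norm_normalI | by left |].
  by right; apply/setIidPl.
(* If [K] has order 2, its generator is even because it lies in [B]; if [K] is larger, a trivial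
   intersection would give more than 120 products. *)
have KA : K :&: A != 1.
  have [oK|oK] := eqVneq #|K| 2.
    have t2 : t0 * t0 = 1.
      have : t0 ^+ #|K| = 1 by apply: expg_cardG; rewrite inK nt0.
      by rewrite oK.
    have [|s ts] := order20_involution_square oB _ t01 t2; first by rewrite nB.
    apply/trivgPn; exists t0 => //; rewrite inE inK nt0 eqxx /=.
    by rewrite mem_Alt5; apply/code_squareP; exists s.
  apply/eqP => KA; have := subset_leq_card (subsetT (K * A)).
  rewrite card_S5 TI_cardMg // oA => leK.
  have : #|K| <= 2 by rewrite -(leq_pmul2r (isT : 0 < 60)).
  by rewrite leqNgt ltn_neqAle eq_sym oK oK1.
have KnA : ~~ (A \subset K).
  apply/negP => /subset_leq_card; rewrite oA => /leq_trans/(_ (dvdn_leq _ oK20)).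
  by move/(_ isT).
have nKA : ~~ (A \subset 'N(K :&: A)).
  apply/negP => /nA1[] KA'; last by rewrite (subset_trans KA') ?subsetIl in KnA.
  by case/eqP: KA; rewrite -KA'; apply/esym/setIidPr/subsetIr.
(* If [a] were trivial on [A], then [n] would be multiplicative there, with kernel [K :&: A] normal
   in [A]. *)
have inja : {in A &, injective a}.
  have [|KA1|AK] := nA1 ('ker a)%G.
  - by rewrite (subset_trans (subsetT _)) // ker_norm.
  - move=> g h Ag Ah agh; apply/eqP; rewrite eq_mulgV1.
    have : g * h^-1 \in A :&: 'ker a.
      rewrite inE groupM ?groupV //=; apply/kerP; first exact: in_setT.
      by rewrite aM morphV ?in_setT // agh mulgV.
    by rewrite KA1 => /set1P/eqP.
  case/negP: nKA; apply/subsetP => h Ah; rewrite inE.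
  apply/subsetP => _ /imsetP[g /setIP[Kg Ag] ->]; apply/setIP; split; last by rewrite groupJ.
  have nAM g1 g2 : g2 \in A -> n (g1 * g2) = n g1 * n g2.
    by move=> Ag2; rewrite nM (mker (subsetP AK _ Ag2)) conjg1.
  by rewrite inK conjgE !nAM ?groupM // (eqP (_ : n g == 1)) -?inK // mul1g -nAM // mulVg n1.
have tiaN : a @* A :&: N = 1.
  apply/trivgP/subsetP => _ /setIP[/morphimP[g _ _ ->] /aN1->].
  exact: group1.
have tiaC : a @* A :&: 'C(N) = 1.
  apply/trivgP/subsetP => _ /setIP[/morphimP[g _ _ ->] /aC1->].
  exact: group1.
have isoA : A \isog a @* A.
  have -> : a @* A = restrm (subsetT A) a @* A by rewrite morphim_restrm setIid.
  by rewrite sub_isog //; apply/injmP => g h Ag Ah; apply: inja.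
have oaA : #|a @* A| = 60 by rewrite -(card_isog isoA).
have simaA : simple (a @* A) by rewrite -(isog_simple isoA).
have naA : a @* A \subset 'N(N).
  by apply/subsetP => _ /morphimP[g _ _ ->].
have oN60 : #|N| = 60.
  apply/eqP/idPn => oN; have oNK' : (#|N| * #|K|)%N = 120 := oNK.
  have oN' : #|N| = 120 %/ #|K| by rewrite -oNK' mulnK.
  have ords : all (fun d => (1 < d) ==> (120 %/ d != 60) ==>
    (120 %/ d \in A5_trivial_orders)) (divisors 20) by vm_compute.
  move/allP/(_ #|K|): ords; rewrite -dvdn_divisors // oK1 -oN' oN => /(_ oK20) /= oN_in.
  have /setIidPl := A5_trivial_action simaA oaA naA (erefl _) oN_in.
  by rewrite tiaC => E; move: oaA; rewrite -E cards1.
have oK : #|K| = 2.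
  by apply/eqP; rewrite -(eqn_pmul2l (isT : 0 < 60)) -{1}oN60 oNK.
have [t KAt t1] := trivgPn _ KA; have [Kt At] := setIP KAt.
have inK2 g : (g \in K) = (g \in [:: 1; t]).
  have /eqP KE : [set 1; t] == K.
    by rewrite eqEcard cards2 eq_sym t1 oK andbT subUset !sub1set group1.
  by rewrite -KE !inE.
have t2 : t * t = 1.
  by have := expg_cardG Kt; rewrite oK.
have [s ts] : exists s, t = s * s by apply/code_squareP; rewrite -mem_Alt5.
have nC : 'N(N) \subset 'N('C(N)) := cent_norm N.
have aNC g : a g \in 'N('C(N)) by apply: (subsetP nC).
have nNC g : n g \in 'N('C(N)) by apply/(subsetP nC)/(subsetP (normG N)).
(* Modulo the centralizer, every element of [N] becomes the image of an element of [a @* A]. *)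
pose pa g := coset 'C(N) (a g).
have paM : {in [set: 'S_5] &, {morph pa : g h / g * h}}.
  by move=> g h _ _; rewrite /pa aM morphM.
apply: (@no_twisted_endomorphism _ t s (Morphism paM) (fun g => coset 'C(N) (n g))) => //.
- move=> g h Ag Ah /= pagh; have agh : a (g * h^-1) = 1.
    apply/aC1/coset_idr => //; rewrite -/(pa _) paM ?in_setT // pagh -paM ?in_setT //.
    by rewrite mulgV /pa morph1 coset_id.
  apply: inja => //; apply/eqP; rewrite eq_mulgV1 -morphV ?in_setT // -aM agh.
  exact: eqxx.
- by move=> g h /=; rewrite /pa -morphJ // -morphM ?groupJ // nM.
- move=> g; have : n g \in N * 'C(N) by rewrite -(mulg1 (n g)) mem_mulg.
  rewrite (mul_cent_eq simaA oaA oN60 naA tiaN tiaC).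
  case/mulsgP=> _ c /morphimP[v _ Av ->] cC ->; exists v => //.
  by rewrite /= /pa coset_kerr.
- move=> g; rewrite -inK2 inK; split=> [ng1|/eqP->]; last by rewrite coset_id ?group1.
  have : n g \in N :&: 'C(N) by rewrite inE nN coset_idr.
  by rewrite (center_trivial simaA oaA oN60 naA tiaN tiaC) => /set1P->.
Qed.

(** In the symmetric group on [rT], the right translations form a group [N] on which the
    permutations [act^~ g] act by conjugation. *)
Lemma no_S5_crossed_hom (rT : finGroupType) (act : rT -> 'S_5 -> rT)
    (c : 'S_5 -> rT) (B : {group 'S_5}) :
  (forall x y g, act (x * y) g = act x g * act y g) ->
  (forall x, act x 1 = x) ->
  (forall x g h, act x (g * h) = act (act x g) h) ->
  (forall g h, c (g * h) = act (c g) h * c h) ->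
  (forall x, exists g, c g = x) ->
  #|B| = 20 -> (forall g, c g = 1 -> g \in B) ->
  (exists2 t, t != 1 & c t = 1) -> False.
Proof.
move=> aM a1 aC cM c_onto oB cB ct.
pose to := TotalAction a1 aC.
pose r := actperm 'R%act : rT -> {perm rT}.
have rE x y : r x y = y * x by rewrite actpermE.
have rM x y : r (x * y) = r x * r y by apply/permP => z; rewrite permM !rE mulgA.
pose rm := @Morphism _ _ [set: rT] r (in2W rM).
pose N := (rm @* [set: rT])%G.
have inN x : r x \in N by apply: (@mem_morphim _ _ _ rm); rewrite in_setT.
have r_inj x y : r x = r y -> x = y.
  by move=> xy; rewrite -[x]mul1g -[y]mul1g -!rE xy.
have Nr p : p \in N -> exists x, p = r x by case/morphimP=> x _ _ ->; exists x.
have act1 g : act 1 g = 1.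
  by apply: (mulgI (act 1 g)); rewrite -aM !mulg1.
pose a := actperm_morphism to.
have aE g x : a g x = act x g by rewrite /= actpermE.
have raJ x g : r x ^ a g = r (act x g).
  apply/permP => y; rewrite conjgE !permM !rE !aE aM; congr (_ * _).
  by rewrite -aE permKV.
apply: (@no_S5_crossed_hom_in _ N a (fun g => r (c g)) B) => //.
- move=> g; rewrite inE; apply/subsetP => _ /imsetP[_ /Nr[x ->] ->].
  by rewrite raJ.
- by move=> g h; rewrite raJ -rM cM.
(* An automorphism fixes 1, and the only translation fixing 1 is trivial. *)
- move=> g /Nr[x gx]; have x1 : x = 1.
    by rewrite -[x]mul1g -rE -gx aE.
  by rewrite gx x1; apply/permP => y; rewrite rE mulg1 perm1.
- move=> g /centP cg; apply/permP => y; rewrite perm1 aE; apply: r_inj.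
  by rewrite -raJ; apply/conjg_fixP/commgP/commute_sym/cg.
(* The fibres of [c] are the right cosets of the fibre over 1. *)
- have oN : #|N| = #|rT|.
    by rewrite card_injm ?cardsT //; apply/injmP => x y _ _; apply: r_inj.
  rewrite oN -card_S5 -[RHS]sum1_card (partition_big c xpredT) //=.
  rewrite -sum_nat_const; apply: eq_bigr => x _; rewrite sum1dep_card.
  have [g0 g0x] := c_onto x; rewrite -(card_rcoset _ g0); congr #|pred_of_set _|.
  apply/setP=> g; rewrite mem_rcoset !inE.
  have -> : c g = act (c (g * g0^-1)) g0 * x by rewrite -g0x -cM mulgKV.
  apply/eqP/eqP => [rg|cg].
    suff -> : c (g * g0^-1) = 1 by rewrite act1 mul1g.
    by apply: r_inj; rewrite rg; apply/permP => y; rewrite rE mulg1 perm1.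
  have {}cg : act (c (g * g0^-1)) g0 = 1 by apply: (mulIg x); rewrite cg mul1g.
  suff -> : c (g * g0^-1) = 1 by apply/permP => y; rewrite rE mulg1 perm1.
  by rewrite -[c _]a1 -(mulgV g0) aC cg act1.
- move=> g rg; apply: cB; apply: r_inj.
  by rewrite rg; apply/permP => y; rewrite rE mulg1 perm1.
- case: ct => t t1 ct1; exists t; rewrite // ct1.
  by apply/permP => y; rewrite rE mulg1 perm1.
Qed.

End CrossedHom.

(** * The convolution group of a Hopf Galois structure *)

Section Hopf.
Import GRing.Theory.
Local Open Scope ring_scope.

(** * Coordinates of linear maps with respect to the operators of H *)

Section Coordinates.
Variables (k : fieldType) (L : fieldExtType k) (F : {subfield L}).
Local Notation E := (subvs_of F).
Variables (H : falgType k) (act : {linear H -> 'End(E)}).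
Hypothesis j_bij : bijective (hopf_galois_map act).

Local Notation n := (\dim {:H}).
Local Notation m := (\dim {:E}).
Local Notation h_ i := ((vbasis {:H})`_i).
Local Notation e_ i := ((vbasis {:E})`_i).

Lemma hopf_galois_mapE (z : tensor E H) x :
  hopf_galois_map act z x =
  \sum_b (\sum_a (z : 'M_(_, _)) a b *: e_ a) * act (h_ b) x.
Proof.
rewrite /hopf_galois_map /tensor_lift sum_lfunE.
under eq_bigr do rewrite sum_lfunE.
rewrite exchange_big; apply: eq_bigr => b _; rewrite mulr_suml.
by apply: eq_bigr => a _; rewrite scale_lfunE comp_lfunE lfunE /= scalerAl.
Qed.

(** Surjectivity of [hopf_galois_map act], applied to the coordinate forms seen as endomorphisms of
    [E] with scalar values. *)
Lemma dual_coordinates :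
  exists u : 'I_m -> 'I_n -> L, forall q x,
    (coord (vbasis {:E}) q x)%:A = \sum_b u q b * vsval (act (h_ b) x).
Proof.
have [ji _ jiK] := j_bij.
have dl q : linear (fun x : E => (coord (vbasis {:E}) q x)%:A : E).
  by move=> a x y; rewrite linearP /= scalerDl scalerA.
pose dL q : {linear E -> E} := HB.pack (fun x : E => (coord (vbasis {:E}) q x)%:A : E)
  (GRing.isLinear.Build _ _ _ _ _ (dl q)).
pose d q : 'End(E) := linfun (dL q).
exists (fun q b => vsval (\sum_a (ji (d q) : 'M_(_, _)) a b *: e_ a)) => q x.
transitivity (vsval (d q x)); first by rewrite /d lfunE -[dL q x]/((coord (vbasis {:E}) q x)%:A) linearZ /= algid1.
rewrite -{1}[d q]jiK hopf_galois_mapE linear_sum; apply: eq_bigr => b _.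
exact: rmorphM.
Qed.

(** Injectivity of [hopf_galois_map act] gives m n <= m^2. *)
Lemma dim_hopf_le : (n <= m)%N.
Proof.
pose jf : 'Hom(tensor E H, 'End(E)) := linfun (tensor_lift (fun s h => (amull s \o act h)%VF)).
have ker0 : lker jf == 0%VS.
  apply/lker0P => y z; rewrite !lfunE; exact: bij_inj.
have := subvf (jf @: fullv); move/dimvS; rewrite limg_dim_eq; last first.
  by rewrite (eqP ker0) capv0.
rewrite !dimvf.
have -> : dim 'End(E) = (dim E * dim E)%N by [].
have -> : dim (tensor E H) = (m * n)%N by [].
by rewrite !dimvf leq_pmul2l // -dimvf adim_gt0.
Qed.

(** The vector [s] stands for the element of L (x) H with coefficients [s i] on the basis of [H]; it
    is paired here with [phi]. *)
Definition galois_coord (s : {ffun 'I_n -> L}) (phi : H -> L) : L :=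
  \sum_i s i * phi (h_ i).

Lemma galois_coord_exists (f : {linear E -> L}) :
  exists s, forall x, f x = galois_coord s (fun h => vsval (act h x)).
Proof.
have [u uE] := dual_coordinates.
exists [ffun b : 'I_n => \sum_(q < m) f (e_ q) * u q b] => x; rewrite /galois_coord.
rewrite {1}(coord_vbasis (memvf x)) linear_sum.
under [RHS]eq_bigr do rewrite ffunE mulr_suml.
rewrite exchange_big; apply: eq_bigr => q _ /=.
rewrite linearZ /= -mulr_algr uE mulr_sumr; apply: eq_bigr => b _.
by rewrite mulrA.
Qed.

(** The matrix [M] has a left inverse [U], hence rank at least m, and only n <= m rows; its rows are
    therefore independent over [L]. *)
Lemma galois_coord_eq0 (s : {ffun 'I_n -> L}) :
  (forall x, galois_coord s (fun h => vsval (act h x)) = 0) -> forall i, s i = 0.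
Proof.
have [u uE] := dual_coordinates => s0.
pose U := \matrix_(q < m, b < n) u q b.
pose M := \matrix_(b < n, p < m) vsval (act (h_ b) (e_ p)).
have UM : U *m M = 1%:M.
  apply/matrixP => q p; rewrite !mxE; under eq_bigr do rewrite !mxE.
  by rewrite -uE coord_free ?(basis_free (vbasisP _)) // scaler_nat eq_sym.
have rM : row_free M.
  rewrite /row_free eqn_leq rank_leq_row (leq_trans dim_hopf_le) //.
  by rewrite -{1}(mxrank1 L m) -UM mxrankM_maxr.
have : \row_i s i == 0.
  rewrite -(mulmx_free_eq0 _ rM); apply/eqP/rowP => p; rewrite !mxE.
  by under eq_bigr do rewrite !mxE; apply: s0.
by move/eqP/rowP => r0 i; have := r0 i; rewrite !mxE.
Qed.

End Coordinates.

(** * Group-like coordinate vectors and their convolution *)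

Section GaloisHopf.
Variables (k : fieldType) (L : splittingFieldType k) (N F : {subfield L}).
Hypotheses (galN : galois 1 N) (sFN : (F <= N)%VS).
Local Notation E := (subvs_of F).
Local Notation gT := (gal_of N).
Variables (H : falgType k) (hH : hopf_structure H) (act : {linear H -> 'End(E)}).
Hypotheses (actP : module_algebra hH act) (j_bij : bijective (hopf_galois_map act)).

Local Notation n := (\dim {:H}).
Local Notation h_ i := ((vbasis {:H})`_i).

Lemma exists_gal_coord :
  exists s : gT -> {ffun 'I_n -> L}, forall (g : gT) (x : E),
    g (vsval x) = galois_coord (s g) (fun h => vsval (act h x)).
Proof.
have ex (g : gT) : exists s, forall x : E,
    g (vsval x) = galois_coord s (fun h => vsval (act h x)).
  exact: (galois_coord_exists j_bij (gal_repr g \o vsval)).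
exact: fin_all_exists ex.
Qed.

(** Applying the inverse of [e] to the coefficients of the difference reduces this to independence
    of the untwisted operators. *)
Lemma twisted_coord_inj (e : gT) (s s' : {ffun 'I_n -> L}) :
  (forall x, galois_coord s (fun h => e (vsval (act h x))) =
             galois_coord s' (fun h => e (vsval (act h x)))) -> s = s'.
Proof.
move=> ss'; apply/ffunP => i.
have lker_e : lker (gal_repr e) == 0%VS := AEnd_lker0 _.
pose e' := ((gal_repr e)^-1)%VF.
have eK : cancel e e' := lker0_lfunK lker_e.
have eK' : cancel e' e.
  exact: lker0_lfunVK.
have [d dE] : {d : {ffun 'I_n -> L} | forall i, d i = e' (s i - s' i)}.
  by exists [ffun i => e' (s i - s' i)] => j; rewrite ffunE.
have edE j : e (d j) = s j - s' j by rewrite dE eK'.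
have d0 : d i = 0.
  apply: (galois_coord_eq0 j_bij) => x; apply: (can_inj eK).
  rewrite rmorph0 /galois_coord rmorph_sum.
  under eq_bigr do rewrite rmorphM /= edE mulrBl.
  by rewrite sumrB; apply/eqP; rewrite subr_eq0; apply/eqP/ss'.
by apply/eqP; rewrite -subr_eq0 -edE d0 rmorph0.
Qed.

Section WithCoord.
Variable s : gT -> {ffun 'I_n -> L}.
Hypothesis sP : forall (g : gT) (x : E),
  g (vsval x) = galois_coord (s g) (fun h => vsval (act h x)).

Lemma gal_act_mul (e : gT) h (x y : E) :
  e (vsval (act h (x * y))) = \sum_a \sum_b (comul hH h : 'M_(_, _)) a b *:
     (e (vsval (act (h_ a) x)) * e (vsval (act (h_ b) y))).
Proof.
rewrite (act_mul actP) /tensor_lift !linear_sum; apply: eq_bigr => a _.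
rewrite !linear_sum; apply: eq_bigr => b _; rewrite !linearZ /=.
by rewrite -rmorphM -rmorphM.
Qed.

(** The comultiplication of the vector [r], nested so that uniqueness of coordinates can be used for
    [x] and [y] separately. *)
Lemma galois_coord_act_mul (r : {ffun 'I_n -> L}) (e : gT) (x y : E) :
  galois_coord r (fun h => e (vsval (act h (x * y)))) =
  galois_coord [ffun a => galois_coord
      [ffun b => \sum_(i < n) (comul hH (h_ i) : 'M_(_, _)) a b *: r i]
      (fun h => e (vsval (act h y)))]
    (fun h => e (vsval (act h x))).
Proof.
rewrite /galois_coord; under eq_bigr do rewrite gal_act_mul mulr_sumr.
rewrite exchange_big; apply: eq_bigr => a _.
under eq_bigr do rewrite mulr_sumr.
rewrite exchange_big ffunE mulr_suml; apply: eq_bigr => b _.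
rewrite ffunE !mulr_suml; apply: eq_bigr => i _.
by rewrite -!scalerAl -scalerAr -mulrA [X in r i * X]mulrC.
Qed.

(* [g] is multiplicative on [F], i.e. its coordinate vector in [L (x) H] is
   group-like. *)
Lemma gal_coord_grouplike g a b :
  \sum_(i < n) (comul hH (h_ i) : 'M_(_, _)) a b *: s g i = s g a * s g b.
Proof.
pose r a := [ffun b => \sum_(i < n) (comul hH (h_ i) : 'M_(_, _)) a b *: s g i].
have id1 x : (1%g : gT) x = x by apply: gal_id.
have gc1 t x : galois_coord t (fun h => (1%g : gT) (vsval (act h x))) =
    galois_coord t (fun h => vsval (act h x)).
  by apply: eq_bigr => i _; rewrite id1.
have eq1 (t t' : {ffun 'I_n -> L}) : (forall x, galois_coord t (fun h => vsval (act h x)) =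
    galois_coord t' (fun h => vsval (act h x))) -> t = t'.
  by move=> tt'; apply: (@twisted_coord_inj 1%g) => x; rewrite !gc1.
suff /ffunP/(_ b) : r a = [ffun b => s g a * s g b] by rewrite !ffunE.
apply/eq1 => y.
suff /ffunP/(_ a) : [ffun a => galois_coord (r a) (fun h => vsval (act h y))] =
     [ffun a => s g a * g (vsval y)].
  rewrite !ffunE => ->; rewrite sP /galois_coord mulr_sumr.
  by apply: eq_bigr => i _; rewrite ffunE mulrA.
apply/eq1 => x; transitivity (g (vsval (x * y))).
  apply/esym; rewrite sP -gc1 galois_coord_act_mul gc1.
  by apply: eq_bigr => c _; rewrite !ffunE gc1.
rewrite -[vsval (x * y)]/(vsval x * vsval y) rmorphM mulrC /= [g (vsval x)]sP /galois_coord mulr_sumr.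
by apply: eq_bigr => i _; rewrite ffunE mulrCA mulrA.
Qed.

(** The right-hand side is multiplicative in [x] because [s f] is group-like, so it is a k-embedding
    of [F] and extends to [N] by normality. *)
Lemma gal_coord_mul_exists (f e : gT) :
  exists d : gT, forall x : E,
    d (vsval x) = galois_coord (s f) (fun h => e (vsval (act h x))).
Proof.
pose phi (x : E) := galois_coord (s f) (fun h => e (vsval (act h x))).
have phiM x y : phi (x * y) = phi x * phi y.
  rewrite /phi galois_coord_act_mul [RHS]mulrC /galois_coord mulr_sumr.
  apply: eq_bigr => a _; rewrite ffunE [RHS]mulrA; congr (_ * _); rewrite mulr_suml.
  by apply: eq_bigr => b _; rewrite ffunE gal_coord_grouplike -mulrA mulrC.
have phi1 : phi 1 = 1.
  transitivity (f (vsval (1 : E))); last by rewrite /= algid1 rmorph1.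
  rewrite sP; apply: eq_bigr => i _; rewrite (act_unit actP).
  by rewrite !linearZ /= algid1 rmorph1.
(* [kHom] takes endomorphisms of [L]; only the values on [F] matter. *)
have philin : linear (phi \o vsproj F).
  move=> a x y; rewrite /phi /galois_coord /= scaler_sumr -big_split.
  by apply: eq_bigr => i _; rewrite !linearP /= mulrDr scalerAr.
pose fL : 'End(L) := linfun (HB.pack (phi \o vsproj F)
  (GRing.isLinear.Build _ _ _ _ _ philin) : {linear L -> L}).
have fLE x : fL (vsval x) = phi x by rewrite lfunE /= vsvalK.
have homf : kHom 1 F fL.
  apply/kHomP; split=> [x y xF yF | x].
    by rewrite -(vsprojK xF) -(vsprojK yF) -[vsval _ * vsval _]/(vsval (vsproj F x * vsproj F y)) !fLE phiM.
  case/vlineP=> a ->; rewrite linearZ /=; congr (_ *: _).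
  by rewrite -(algid1 F) -[algid F]/(vsval (1 : E)) fLE phi1 /= algid1.
have /and3P[_ _ nN] := galN.
have [|d _ dE] := kHom_to_gal _ nN homf; first by rewrite sub1v.
by exists d => x; rewrite -dE ?subvsP // fLE.
Qed.

Lemma act_linear (e : gT) (x : E) : linear (fun h => e (vsval (act h x))).
Proof.
by move=> a h h'; rewrite linearP add_lfunE scale_lfunE !linearP.
Qed.

(** The vector of [d] is the product of [s e] and [s f], in this order, in the algebra L (x) H; [t]
    is that product. *)
Lemma galois_coord_mul (f e d : gT) :
  (forall x : E, d (vsval x) = galois_coord (s f) (fun h => e (vsval (act h x)))) ->
  forall psi : H -> L, linear psi -> galois_coord (s d) psi =
    galois_coord (s f) (fun h => galois_coord (s e) (fun h' => psi (h' * h))).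
Proof.
move=> dE.
pose t := [ffun c : 'I_n => galois_coord (s f) (fun h => galois_coord (s e)
   (fun h' => (coord (vbasis {:H}) c (h' * h))%:A))].
have expand (psi : H -> L) : linear psi -> galois_coord t psi =
    galois_coord (s f) (fun h => galois_coord (s e) (fun h' => psi (h' * h))).
  move=> psi_lin.
  pose psiL : {linear H -> L} := HB.pack psi (GRing.isLinear.Build _ _ _ _ _ psi_lin).
  rewrite /galois_coord; under eq_bigr do rewrite ffunE mulr_suml.
  rewrite exchange_big; apply: eq_bigr => i _ /=.
  under eq_bigr do rewrite -mulrA mulr_suml.
  rewrite -mulr_sumr exchange_big; congr (_ * _); apply: eq_bigr => j _ /=.
  rewrite [in RHS](coord_vbasis (memvf (h_ j * h_ i))) -[psi (\sum_(_ < _) _)]/(psiL _).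
  rewrite linear_sum mulr_sumr.
  by apply: eq_bigr => c _; rewrite linearZ /= -mulrA mulr_algl.
suff -> : s d = t by apply: expand.
apply: (@twisted_coord_inj 1%g) => x; rewrite (expand _ (act_linear _ _)).
have gc1 r y : galois_coord r (fun h => (1%g : gT) (vsval (act h y))) =
    galois_coord r (fun h => vsval (act h y)).
  by apply: eq_bigr => i _; rewrite gal_id.
rewrite gc1 -sP dE; apply: eq_bigr => i _; rewrite sP; congr (_ * _).
by apply: eq_bigr => j _; rewrite gal_id (Defs.actM actP).
Qed.

End WithCoord.

(** [rT] is the set of embeddings of [F] in [N], [c] is restriction to [F], and the group law is the
    opposite product of coordinate vectors in L (x) H. *)
Lemma exists_convolution_group :
  exists (rT : finGroupType) (c : gT -> rT) (s : gT -> {ffun 'I_n -> L}),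
  [/\ forall (g : gT) (x : E),
        g (vsval x) = galois_coord (s g) (fun h => vsval (act h x)),
      forall t, exists g, c g = t,
      forall f e, c f = c e <-> forall x : E, f (vsval x) = e (vsval x),
      c 1%g = 1%g &
      forall f e d, c d = (c f * c e)%g -> forall x : E,
        d (vsval x) = galois_coord (s f) (fun h => e (vsval (act h x)))].
Proof.
have [s sP] := exists_gal_coord.
(* An embedding is recorded by its values on a basis of [F], which makes their set a finite type. *)
pose res (g : gT) := [ffun i : 'I_(\dim {:E}) => g (vsval (vbasis {:E})`_i)].
pose T := seq_sub (codom res).
pose c g : T := SeqSub (codom_f res g).
have c_onto t : exists g, c g = t.
  by have /codomP[g tE] := ssvalP t; exists g; apply/val_inj; rewrite /= -tE.
have cE f e : c f = c e <-> forall x : E, f (vsval x) = e (vsval x).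
  split=> [/(congr1 val)/= fe x|fe]; last first.
    by apply/val_inj/ffunP => i; rewrite /= !ffunE.
  rewrite (coord_vbasis (memvf x)) !linear_sum; apply: eq_bigr => i _.
  by rewrite !linearZ /=; have /ffunP/(_ i) := fe; rewrite !ffunE => ->.
have sE f e : c f = c e -> s f = s e.
  move/cE => fe; apply: (@twisted_coord_inj 1%g) => x.
  by have := fe x; rewrite !sP => feE;
    transitivity (galois_coord (s f) (fun h => vsval (act h x)));
    [|rewrite feE]; apply: eq_bigr => i _; rewrite gal_id.
have [rep repK] : exists rep : T -> gT, forall t, c (rep t) = t.
  exact: fin_all_exists c_onto.
(* Well defined, since by [sE] the vector [s f] depends only on the restriction of [f]. *)
have [op opE] : exists op : T * T -> T, forall p f e d,
    c f = p.1 -> c e = p.2 -> (c d = op p <-> forall x : E,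
      d (vsval x) = galois_coord (s f) (fun h => e (vsval (act h x)))).
  have ex p : exists t, forall f e d,
    c f = p.1 -> c e = p.2 -> (c d = t <-> forall x : E,
      d (vsval x) = galois_coord (s f) (fun h => e (vsval (act h x)))).
    have [g gE] := gal_coord_mul_exists sP (rep p.1) (rep p.2).
    exists (c g) => f e d fE eE.
    have gfe x : g (vsval x) = galois_coord (s f) (fun h => e (vsval (act h x))).
      rewrite gE (@sE (rep p.1) f) ?repK //; apply: eq_bigr => i _.
      by have /cE -> : c (rep p.2) = c e by rewrite repK.
    split=> [/cE de x|de]; first by rewrite de gfe.
    by apply/cE => x; rewrite de gfe.
  exact: fin_all_exists ex.
pose mul t u := op (t, u).
have mulE f e d : c d = mul (c f) (c e) <-> forall x : E,
    d (vsval x) = galois_coord (s f) (fun h => e (vsval (act h x))).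
  exact: opE.
have mul1 : left_id (c 1%g) mul.
  move=> t; rewrite -(repK t); apply/esym/mulE => x.
  have psi_lin := act_linear (rep t) x.
  pose psiL : {linear H -> L} := HB.pack (fun h => rep t (vsval (act h x)))
    (GRing.isLinear.Build _ _ _ _ _ psi_lin).
  have -> : s 1%g = [ffun i : 'I_n => (coord (vbasis {:H}) i 1)%:A].
    apply: (@twisted_coord_inj 1%g) => y.
    transitivity (vsval y).
      rewrite -[RHS](gal_id N) sP.
      by apply: eq_bigr => i _; rewrite gal_id.
    rewrite -{1}(Defs.act1 actP y) {1}(coord_vbasis (memvf (1 : H))).
    rewrite linear_sum sum_lfunE linear_sum; apply: eq_bigr => i _.
    by rewrite linearZ scale_lfunE linearZ /= ffunE gal_id mulr_algl.
  rewrite -{1}(Defs.act1 actP x) -[LHS]/(psiL 1) {1}(coord_vbasis (memvf (1 : H))).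
  rewrite linear_sum; apply: eq_bigr => i _.
  by rewrite linearZ /= ffunE mulr_algl.
have mulA : associative mul.
  move=> t u w; rewrite -(repK t) -(repK u) -(repK w).
  set f := rep t; set e := rep u; set d := rep w.
  rewrite -(repK (mul (c e) (c d))) -(repK (mul (c f) (c e))).
  set a := rep _; set b := rep _.
  have aE := (mulE e d a).1 (repK _); have bE := (mulE f e b).1 (repK _).
  rewrite -(repK (mul (c b) (c d))); apply/esym/mulE => x.
  rewrite (mulE b d _).1 ?repK // (galois_coord_mul sP bE (act_linear d x)).
  apply: eq_bigr => i _; rewrite aE; congr (_ * _).
  by apply: eq_bigr => j _; rewrite (Defs.actM actP).
have inv_ex t : exists u, mul u t = c 1%g.
  (* On a finite set an injective right multiplication is onto, which gives left inverses. *)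
  have mul_inj : injective (mul^~ t).
    move=> u u' /=; rewrite -(repK u) -(repK u') -(repK t).
    set f := rep u; set f' := rep u'; set e := rep t => ff'.
    have d1 := (mulE f e _).1 (repK _).
    have d2 := (mulE f' e _).1 (etrans (repK _) ff').
    apply/cE => x; rewrite !sP (_ : s f = s f') //.
    by apply: (@twisted_coord_inj e) => y; rewrite -d1 -d2.
  by have [g _ gK] := injF_bij mul_inj; exists (g (c 1%g)); apply: gK.
have [inv mulV] : exists inv, left_inverse (c 1%g) inv mul.
  exact: fin_all_exists inv_ex.
pose rT : finGroupType := HB.pack T (Finite_isGroup.Build T mulA mul1 mulV).
exists rT, c, s; split=> // f e d.
by move/mulE.
Qed.
End GaloisHopf.

(** The action is defined by forcing the crossed homomorphism rule: [act (c g) h] is [c (g * h)]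
    times the inverse of [c h]. The main point is that it respects products. *)
Lemma hopf_galois_crossed_hom (k : fieldType) (L : splittingFieldType k)
    (N F : {subfield L}) :
  galois 1 N -> (F <= N)%VS -> hopf_galois (subvs_of F) ->
  exists (rT : finGroupType) (act : rT -> gal_of N -> rT) (c : gal_of N -> rT),
  [/\ forall x y g, act (x * y)%g g = (act x g * act y g)%g,
      forall x, act x 1%g = x,
      forall x g h, act x (g * h)%g = act (act x g) h,
      forall g h, c (g * h)%g = (act (c g) h * c h)%g &
      (forall x, exists g, c g = x) /\
      forall g, c g = 1%g <-> {in F, forall x, g x = x}].
Proof.
move=> galN sFN [H [hH [act [_ actP j_bij]]]].
have [rT [c [s [sP c_onto cE c1 cM]]]] := exists_convolution_group galN sFN actP j_bij.
have galME (g h : gal_of N) (x : subvs_of F) : (g * h)%g (vsval x) = h (g (vsval x)).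
  by rewrite galM // (subvP sFN) ?subvsP.
have c_transl f f' g : c f = c f' -> c (f * g)%g = c (f' * g)%g.
  by move/cE => ff'; apply/cE => x; rewrite !galME ff'.
have [rep repK] : exists rep : rT -> gal_of N, forall t, c (rep t) = t.
  exact: fin_all_exists c_onto.
have [ac acD] : {ac : rT -> gal_of N -> rT |
    forall t g, ac t g = (c (rep t * g) * (c g)^-1)%g}.
  by exists (fun t g => (c (rep t * g) * (c g)^-1)%g).
have acE f g : (ac (c f) g * c g)%g = c (f * g)%g.
  by rewrite acD mulgKV; apply: c_transl; rewrite repK.
have acM x y g : ac (x * y)%g g = (ac x g * ac y g)%g.
  rewrite -(repK x) -(repK y) -(repK (c _ * c _)%g).
  set f := rep x; set e := rep y; set m := rep _.
  have cm : c m = (c f * c e)%g := repK _.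
  apply: (mulIg (c g)); rewrite -mulgA !acE.
  have [a aE] := c_onto (ac (c f) g); rewrite -aE.
  (* Acting by [g] on an embedding applies [g] to its coordinates. *)
  have sa i : s a i = g (s f i).
    suff -> : s a = [ffun i => g (s f i)] by rewrite ffunE.
    apply: (twisted_coord_inj j_bij (e := g)) => z.
    rewrite -(cM a g (f * g)%g) ?aE ?acE // galME sP rmorph_sum.
    by apply: eq_bigr => j _; rewrite rmorphM ffunE.
  rewrite -(repK (c a * _)%g); apply/esym/cE => z.
  rewrite (cM a (e * g)%g) ?repK // galME (cM f e m cm) rmorph_sum.
  by apply: eq_bigr => j _; rewrite rmorphM /= sa galME.
exists rT, ac, c; split=> //.
- by move=> x; rewrite acD mulg1 repK c1 invg1 mulg1.
- move=> x g h; apply: (mulIg (c (g * h)%g)); rewrite -(repK x) acE mulgA.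
  by rewrite -(acE g h) mulgA -acM !acE.
split=> // g; rewrite -c1; split=> [/cE gE x xF|gE].
  by rewrite -(vsprojK xF) gE gal_id.
by apply/cE => x; rewrite gE ?subvsP // gal_id.
Qed.

End Hopf.

(** * Transport to S_5 and conclusion *)

Theorem proposition4p11 (k : fieldType) (L : splittingFieldType k)
    (K N F : {subfield L}) :
  separable 1 K -> \dim K = 6 -> galois_closure K N ->
  ('Gal(N / 1) \isog [set: 'S_5])%g ->
  (K <= F)%VS -> (F <= N)%VS -> F != N :> {vspace L} ->
  ~ hopf_galois (subvs_of F).
Proof.
move=> _ dimK [sKN galN _] isoG sKF sFN neFN hopfF.
have [rT [act [c [actM act1 actC cM [c_onto cE]]]]] :=
  hopf_galois_crossed_hom galN sFN hopfF.
have [f injf fG] := isogP (etrans (isog_sym _ _) isoG).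
have galT (g : gal_of N) : g \in 'Gal(N / 1)%g by rewrite gal_kHom ?sub1v ?k1AHom.
have fM : {morph f : x y / (x * y)%g} by move=> x y; rewrite morphM ?inE.
have f_onto g : exists x, f x = g.
  by have := galT g; rewrite -fG => /morphimP[x _ _ ->]; exists x.
have dimN : \dim N = 120.
  by have := galois_dim galN; rewrite dimv1 divn1 (card_isog isoG) card_S5.
have galKN : galois K N by rewrite (galoisS _ galN) // sub1v.
have galFN : galois F N by rewrite (galoisS _ galN) // sub1v.
(* [B] has order 120 / 6 = 20, and it contains the preimage of the Galois group over [F] because [K]
   lies in [F]. *)
pose B := (f @*^-1 'Gal(N / K))%G.
apply: (@no_S5_crossed_hom rT (fun x g => act x (f g)) (c \o f) B) => //=.
- by move=> x; rewrite morph1 act1.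
- by move=> x g h; rewrite fM actC.
- by move=> g h; rewrite fM cM.
- by move=> x; have [g <-] := c_onto x; have [y <-] := f_onto g; exists y.
- rewrite -(card_injm injf) ?subsetT // morphpreK; last by rewrite fG; apply/subsetP.
  by rewrite -(galois_dim galKN) dimN dimK.
- move=> g /cE gE; apply/morphpreP; split; first exact: in_setT.
  rewrite gal_kHom //; apply/kHomP; split=> [x y _ _|x xK]; first exact: GRing.rmorphM.
  exact/gE/(subvP sKF).
(* [F] differs from [N], so some nontrivial automorphism fixes [F]; it provides the nontrivial zero
   [t] of the crossed homomorphism. *)
have /trivgPn[g gF g1] : 'Gal(N / F)%g != 1%g.
  apply: contraNneq neFN => G1; have := galois_dim galFN.
  rewrite G1 cards1 => dimNF; rewrite eqEdim sFN /=.
  by rewrite -(divnK (field_dimS sFN)) dimNF mul1n.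
have [t tg] := f_onto g; exists t; first by apply: contraNneq g1 => t1; rewrite -tg t1 morph1.
by apply/cE => x xF; rewrite tg (fixed_gal sFN gF).
Qed.
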